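(* Let $P$ be a finite poset. If $A$ is a maximal $r$-antichain of $P$ and $B$ is a maximal $r'$-antichain of $P$, where $A$ and $B$ are incomparable in the filter order, then $A \wedge B$ is a maximal $q$-antichain of $P$ for some $q > \max(r, r')$.
   Context: For an antichain $A$ of $P$ let $[A) = \{x \in P \mid x \geq y \text{ for some } y \in A\}$. The set of all antichains of $P$ is ordered by the filter order: $A \leq B$ iff $[A) \supseteq [B)$. With this order it is a lattice in which $A \wedge B$ is the set of minimal elements of $A \cup B$. An antichain $A$ of $P$ is a maximal $r$-antichain iff $|A| = r$ and $A$ is maximal (in the filter order) among the $r$-element antichains of $P$. *)

(* Defs.v *)
From mathcomp Require Import all_boot all_order.

Set Implicit Arguments.
Unset Strict Implicit.
Unset Printing Implicit Defensive.

Import Order.TTheory.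
Local Open Scope order_scope.

Definition antichain (d : Order.disp_t) (P : finPOrderType d) (A : {set P})
    : bool :=
  [forall x in A, forall y in A, (x != y) ==> (x >< y)].

Definition up_closure (d : Order.disp_t) (P : finPOrderType d) (A : {set P})
    : {set P} :=
  [set x | [exists y in A, y <= x]].

(* The filter order reverses inclusion of the generated filters. It is an order
   on antichains only (see filter_le_anti), not on arbitrary subsets. *)
Definition filter_le (d : Order.disp_t) (P : finPOrderType d) (A B : {set P})
    : bool :=
  up_closure B \subset up_closure A.

Definition filter_incomparable (d : Order.disp_t) (P : finPOrderType d)
    (A B : {set P}) : bool :=
  ~~ filter_le A B && ~~ filter_le B A.

Definition minimal_elements (d : Order.disp_t) (P : finPOrderType d)
    (S : {set P}) : {set P} :=
  [set x in S | [forall y in S, ~~ (y < x)]].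

(* The lattice meet of two antichains in the filter order: see
   antichain_meet_antichain and antichain_meet_glb. *)
Definition antichain_meet (d : Order.disp_t) (P : finPOrderType d)
    (A B : {set P}) : {set P} :=
  minimal_elements (A :|: B).

Definition maximal_antichain (d : Order.disp_t) (P : finPOrderType d) (r : nat)
    (A : {set P}) : Prop :=
  [/\ antichain A, #|A| = r &
      forall C : {set P},
        antichain C -> #|C| = r -> filter_le A C -> C = A].

Section FilterOrderFacts.
Context (d : Order.disp_t) (P : finPOrderType d).
Implicit Types (A B C S : {set P}) (x y : P).

Lemma antichainP A :
  reflect {in A &, forall x y, x <= y -> x = y} (antichain A).
Proof.
apply: (iffP forall_inP) => [acA x y xA yA lexy | acA x xA].
  have /forall_inP/(_ y yA) := acA x xA.
  by case: eqVneq => //= _; rewrite /Order.comparable lexy.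
apply/forall_inP => y yA; apply/implyP => neq.
apply/negP; case/orP => le; move/eqP: neq; apply; first exact: acA.
by apply/esym; apply: acA.
Qed.

Lemma up_closureP A x :
  reflect (exists2 y, y \in A & y <= x) (x \in up_closure A).
Proof. by rewrite inE; apply: exists_inP. Qed.

Lemma filter_le_refl A : filter_le A A.
Proof. exact: subxx. Qed.

Lemma filter_le_trans B A C : filter_le A B -> filter_le B C -> filter_le A C.
Proof. by move=> AB BC; apply: subset_trans BC AB. Qed.

Lemma filter_le_anti A B :
  antichain A -> antichain B -> filter_le A B -> filter_le B A -> A = B.
Proof.
have sub S T : antichain S ->
    filter_le S T -> filter_le T S -> S \subset T.
  move=> /antichainP acS ST TS; apply/subsetP => x xS.
  have /(subsetP TS)/up_closureP[y yT leyx] : x \in up_closure S.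
    by apply/up_closureP; exists x.
  have /(subsetP ST)/up_closureP[z zS lezy] : y \in up_closure T.
    by apply/up_closureP; exists y.
  have zx := acS _ _ zS xS (le_trans lezy leyx).
  suff -> : x = y by [].
  by apply/eqP; rewrite eq_le leyx -{1}zx lezy.
by move=> acA acB AB BA; apply/eqP; rewrite eqEsubset !sub.
Qed.

Lemma antichain_meet_antichain A B : antichain (antichain_meet A B).
Proof.
apply/antichainP => x y; rewrite !inE -!in_setU.
case/andP=> xS _ /andP[_ /forall_inP ymin] lexy.
by have := ymin x xS; rewrite lt_neqAle lexy andbT negbK => /eqP.
Qed.

Lemma minimal_elements_below S x :
  x \in S -> exists2 y, y \in minimal_elements S & y <= x.
Proof.
have [n] := ubnP #|[set y in S | y < x]|; elim: n x => // n IHn x ltn xS.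
have [/forall_inP xmin | ] := boolP [forall y in S, ~~ (y < x)].
  by exists x; rewrite // inE xS; apply/forall_inP.
rewrite negb_forall_in => /exists_inP[y yS]; rewrite negbK => ltyx.
have [|z zmin lezy] := IHn y _ yS; last first.
  by exists z => //; apply: le_trans lezy (ltW ltyx).
apply: leq_trans (ltn : (_ <= n)%N); apply: proper_card; apply/properP; split.
  apply/subsetP => z; rewrite !inE => /andP[-> ltzy].
  exact: lt_trans ltzy ltyx.
by exists y; rewrite !inE ?yS ?ltxx.
Qed.

Lemma up_closure_meet A B :
  up_closure (antichain_meet A B) = up_closure A :|: up_closure B.
Proof.
apply/setP => x; rewrite in_setU; apply/up_closureP/orP.
  case=> y; rewrite inE in_setU => /andP[/orP[yA|yB] _] leyx;
    [left | right]; by apply/up_closureP; exists y.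
have below y : y \in A :|: B -> y <= x ->
    exists2 z, z \in antichain_meet A B & z <= x.
  move=> /minimal_elements_below[z zm lezy] leyx.
  by exists z => //; apply: le_trans leyx.
by case=> /up_closureP[y yS]; apply: below; rewrite in_setU yS ?orbT.
Qed.

Lemma antichain_meet_glb A B C :
  filter_le C (antichain_meet A B) = filter_le C A && filter_le C B.
Proof. by rewrite /filter_le up_closure_meet subUset. Qed.

End FilterOrderFacts.

(* Main.v *)
(** The elements of [A :|: B] lying in both generated filters form an antichain
    [N] above [A] and [B] with [#|A /\ B| + #|N| = #|A| + #|B|]. An antichain
    strictly above a maximal r-antichain [A] has fewer than [r] elements, so
    meeting with [A] never shrinks an antichain [C], and preserves its size only
    if [C <= A]. This gives the strict growth of [#|A /\ B|]. If [C >= A /\ B]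
    has the size of [A /\ B], then [A /\ B = (C /\ A) /\ B] forces both steps to
    preserve the size, whence [C <= A], and [C <= B] by symmetry. *)

Require Import Defs.
From mathcomp Require Import all_boot all_order.

Import Order.TTheory.
Local Open Scope order_scope.

Section MaximalAntichains.
Context (d : Order.disp_t) (P : finPOrderType d).
Implicit Types (A B C : {set P}) (x y : P).

Lemma antichain_subset A B : A \subset B -> antichain B -> antichain A.
Proof.
move=> /subsetP sAB /antichainP acB; apply/antichainP => x y xA yA.
by apply: acB; apply: sAB.
Qed.

Lemma sub_up_closure A : A \subset up_closure A.
Proof. by apply/subsetP => x xA; apply/up_closureP; exists x. Qed.

Lemma filter_leP A B : reflect (B \subset up_closure A) (filter_le A B).
Proof.
apply: (iffP idP) => [|/subsetP sBA].
  exact: subset_trans (sub_up_closure B).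
apply/subsetP => x /up_closureP[y /sBA/up_closureP[z zA lezy] leyx].
by apply/up_closureP; exists z => //; apply: le_trans leyx.
Qed.

Lemma filter_le_subset A B : A \subset B -> filter_le B A.
Proof. by move=> sAB; apply/filter_leP/(subset_trans sAB)/sub_up_closure. Qed.

Lemma antichain_meetC A B : antichain_meet A B = antichain_meet B A.
Proof. by rewrite /antichain_meet setUC. Qed.

Lemma antichain_meet_lel A B : filter_le (antichain_meet A B) A.
Proof.
by have := antichain_meet_glb A B (antichain_meet A B);
  rewrite filter_le_refl => /esym/andP[].
Qed.

Lemma antichain_meet_ler A B : filter_le (antichain_meet A B) B.
Proof. by rewrite antichain_meetC antichain_meet_lel. Qed.

Lemma antichain_meet_idPr A C :
  antichain C -> filter_le C A -> antichain_meet A C = C.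
Proof.
move=> acC leCA; apply: filter_le_anti (antichain_meet_ler A C) _ => //.
  exact: antichain_meet_antichain.
by rewrite antichain_meet_glb leCA filter_le_refl.
Qed.

(* In general not the lattice join, which consists of the minimal elements of
   the intersection of the two filters. *)
Definition common_upper A B : {set P} :=
  (A :|: B) :&: (up_closure A :&: up_closure B).

Lemma common_upper_gel A B : filter_le A (common_upper A B).
Proof.
by apply/filter_leP/subsetP => x; rewrite !in_setI => /and3P[].
Qed.

Lemma common_upper_ger A B : filter_le B (common_upper A B).
Proof.
by apply/filter_leP/subsetP => x; rewrite !in_setI => /and3P[].
Qed.

(** Given members [x <= y] with [y] in [A], some [a] in [A] lies below [x]; then [a <= x <= y]
    forces [a = y], hence [x = y]. The case of [y] in [B] is the same. *)
Lemma common_upper_antichain A B :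
  antichain A -> antichain B -> antichain (common_upper A B).
Proof.
move=> /antichainP acA /antichainP acB; apply/antichainP => x y.
rewrite !in_setI => /and3P[_ /up_closureP[a aA leax] /up_closureP[b bB lebx]].
case/andP=> /setUP[yA|yB] _ lexy; apply/le_anti; rewrite lexy /=.
  by rewrite -(acA a y) // (le_trans leax).
by rewrite -(acB b y) // (le_trans lebx).
Qed.

(** Anything in the union strictly below [x] comes from the other antichain, so it puts [x] in both
    filters and [x] is not in both antichains. Conversely, a minimal [x] in both filters equals the
    elements of [A] and of [B] below it. *)
Lemma antichain_meetE A B x : antichain A -> antichain B ->
  (x \in antichain_meet A B) =
  (x \in A :|: B) &&
  ((x \in up_closure A :&: up_closure B) ==> (x \in A :&: B)).
Proof.
move=> /antichainP acA /antichainP acB; rewrite in_set.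
have [xAB /=|//] := boolP (x \in A :|: B).
apply/forall_inP/implyP => [xmin | xI y yAB].
  rewrite !in_setI.
  have mem (S : {set P}) : S \subset A :|: B -> x \in up_closure S -> x \in S.
    move=> /subsetP sS /up_closureP[y yS].
    by rewrite le_eqVlt (negPf (xmin y (sS y yS))) orbF => /eqP <-.
  by case/andP=> upA upB; rewrite (mem A) ?subsetUl // (mem B) ?subsetUr.
apply/negP => ltyx.
have neq : y <> x by move=> eyx; rewrite eyx ltxx in ltyx.
have leyx := ltW ltyx.
have up (S : {set P}) : x \in S -> x \in up_closure S.
  exact/subsetP/sub_up_closure.
suff /xI : x \in up_closure A :&: up_closure B.
  case/setIP=> xA xB; case/setUP: yAB => [yA | yB]; apply: neq.
    exact: acA.
  exact: acB.
rewrite in_setI; case/setUP: xAB => [xA|xB]; case/setUP: yAB => [yA|yB].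
- by case: neq; apply: acA.
- by rewrite up //=; apply/up_closureP; exists y.
- by rewrite (up B) // andbT; apply/up_closureP; exists y.
- by case: neq; apply: acB.
Qed.

(** The two sets on the left have the same union and the same intersection as [A] and [B]. *)
Lemma card_antichain_meet A B : antichain A -> antichain B ->
  (#|antichain_meet A B| + #|common_upper A B| = #|A| + #|B|)%N.
Proof.
move=> acA acB.
have eU : antichain_meet A B :|: common_upper A B = A :|: B.
  apply/setP => x; rewrite in_setU antichain_meetE //
    [_ \in common_upper _ _]in_setI.
  by case: (x \in A :|: B); case: (x \in up_closure A :&: up_closure B);
    rewrite ?orbT.
have eI : antichain_meet A B :&: common_upper A B = A :&: B.
  apply/setP => x; rewrite in_setI antichain_meetE //
    [_ \in common_upper _ _]in_setI.
  apply/idP/idP => [/andP[/andP[_ /implyP upI] /andP[_ /upI]] // | xI].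
  have -> : x \in A :|: B by case/setIP: xI => xA _; rewrite in_setU xA.
  rewrite xI implybT /=.
  by apply: subsetP xI; rewrite setISS ?sub_up_closure.
by rewrite -cardsUI eU eI cardsUI.
Qed.

(** If [C] has at least [r] elements, an [r]-element subset of [C] is again above [A], so it is [A]
    by maximality. Then [A] is contained in [C], which gives [C <= A] and so [C = A]. *)
Lemma maximal_antichain_above r A C : maximal_antichain r A ->
  antichain C -> filter_le A C -> (#|C| <= r ?= iff (C == A))%N.
Proof.
case=> acA cardA maxA acC leAC.
have eqCA : (r <= #|C|)%N -> C = A.
  move=> ler.
  have [D sDC cardD] : exists2 D : {set P}, D \subset C & #|D| = r.
    have /card_gt0P[D] : (0 < #|[set D : {set P} | D \subset C & #|D| == r]|)%N.
      by rewrite cards_draws bin_gt0.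
    by rewrite inE => /andP[sDC /eqP]; exists D.
  have leCD := filter_le_subset _ _ sDC.
  have eDA : D = A.
    apply: maxA => //; first exact: antichain_subset acC.
    exact: filter_le_trans leCD.
  by apply: filter_le_anti => //; rewrite -eDA.
split.
  rewrite leqNgt; apply/negP => ltr; have := ltr.
  by rewrite (eqCA (ltnW ltr)) cardA ltnn.
apply/eqP/eqP => [eqr | ->//].
by apply: eqCA; rewrite eqr.
Qed.

Lemma leqif_card_meet r A C : maximal_antichain r A -> antichain C ->
  (#|C| <= #|antichain_meet A C| ?= iff filter_le C A)%N.
Proof.
move=> mA acC; have [acA cardA _] := mA.
have acN := common_upper_antichain A C acA acC.
have [leN eqN] := maximal_antichain_above r A _ mA acN (common_upper_gel A C).
have cardM := card_antichain_meet A C acA acC.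
have leC : (#|C| <= #|antichain_meet A C|)%N.
  by rewrite -(leq_add2l r) -{1}cardA -cardM addnC leq_add2r.
split=> //; apply/eqP/idP => [eC | leCA]; last first.
  by rewrite antichain_meet_idPr.
(* By the counting identity, equal sizes leave [common_upper A C] with exactly [r] elements. *)
have /eqP eNA : common_upper A C == A.
  by rewrite -eqN; apply/eqP/(@addnI #|C|); rewrite {1}eC cardM cardA addnC.
by rewrite -eNA common_upper_ger.
Qed.

Lemma card_meet_above r r' A B C :
  maximal_antichain r A -> maximal_antichain r' B -> antichain C ->
  filter_le (antichain_meet A B) C -> #|C| = #|antichain_meet A B| ->
  filter_le C A.
Proof.
move=> mA mB acC leMC cardC.
have acD := antichain_meet_antichain A C.
have eM : antichain_meet B (antichain_meet A C) = antichain_meet A B.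
  apply: filter_le_anti; try exact: antichain_meet_antichain.
    rewrite antichain_meet_glb antichain_meet_lel andbT.
    exact: filter_le_trans (antichain_meet_ler _ _) (antichain_meet_lel _ _).
  by rewrite !antichain_meet_glb antichain_meet_ler antichain_meet_lel.
have leCD := leqif_card_meet r A C mA acC.
have leDM := leqif_card_meet r' B _ mB acD.
(* The sizes of [C], [antichain_meet A C] and [antichain_meet A B] increase weakly, and the outer
   two agree. *)
by rewrite -(geq_leqif leCD) cardC -eM leDM.
Qed.

End MaximalAntichains.

Theorem corollary3p7p4 (d : Order.disp_t) (P : finPOrderType d)
    (r r' : nat) (A B : {set P}) :
  maximal_antichain r A ->
  maximal_antichain r' B ->
  filter_incomparable A B ->
  exists q : nat,
    (maxn r r' < q)%N /\ maximal_antichain q (antichain_meet A B).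
Proof.
move=> mA mB /andP[nleAB nleBA].
have [acA cardA _] := mA; have [acB cardB _] := mB.
exists #|antichain_meet A B|; split.
  rewrite gtn_max -{1}cardA -cardB.
  (* Each half of incomparability excludes one equality case. *)
  rewrite (ltn_leqif (leqif_card_meet _ _ r A B mA acB)) nleBA andbT.
  by rewrite antichain_meetC (ltn_leqif (leqif_card_meet _ _ r' B A mB acA)).
split=> [||C acC cardC leMC] //; first exact: antichain_meet_antichain.
apply: filter_le_anti => //; first exact: antichain_meet_antichain.
rewrite antichain_meet_glb (card_meet_above _ _ r r' A B) //=.
by apply: (card_meet_above _ _ r' r B A) => //; rewrite antichain_meetC.
Qed.
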